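(* Let $\frac mn$ be a positive irreducible fraction and let $\Omega$ be a finite set of positive integers. Then there are infinitely many ways to choose a nonnegative integer $t$, an integer $x$ and positive integers $b_1,\dots,b_{t+1}$ such that \[ \frac mn=\frac1{b_1}+\cdots+\frac1{b_t}+\frac{x}{b_{t+1}}+\frac1{n b_1\cdots b_t b_{t+1}} \] is a faithful decomposition of $\frac mn$, where for each $1\le i\le t+1$, $b_i$ is coprime to every element of $\{b_j\}_{j\ne i}\cup\Omega$.
   Context: A (fraction) decomposition of a positive rational $\frac mn$ is an expression $\frac mn=\frac{a_1}{b_1}+\cdots+\frac{a_k}{b_k}$ where $a_1,\dots,a_k$ are positive integers and $b_1,\dots,b_k$ are pairwise distinct positive integers; $k$ is its length. For a positive irreducible fraction $u=\frac mn$, such a decomposition is called faithful if for all integers $x_1,\dots,x_k$ with $0\le x_i\le a_i$, the number $v=\sum_{i=1}^k \frac{x_i}{b_i}$ does not lie in $\frac1n\mathbb Z$ unless $v=u$ or $v=0$. *)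

(* Defs.v *)
From mathcomp Require Import all_boot all_order all_algebra.
From mathcomp Require Import finmap.
From mathcomp Require Import classical_sets cardinality.

Set Implicit Arguments.
Unset Strict Implicit.
Unset Printing Implicit Defensive.

Import Order.TTheory GRing.Theory Num.Theory.
Local Open Scope ring_scope.

Definition frac_sum (k : nat) (a : 'I_k -> int) (b : k.-tuple nat) : rat :=
  \sum_(i < k) (a i)%:~R / (tnth b i)%:R.

Definition decomposition (u : rat) (k : nat)
    (a : k.-tuple int) (b : k.-tuple nat) : Prop :=
  [/\ forall i, 0 < tnth a i,
      forall i, (0 < tnth b i)%N,
      uniq b
    & u = frac_sum (tnth a) b].

(* [m / n] is meant to be irreducible: the condition refers to the given
   denominator [n]. *)
Definition faithful_decomposition (m n : nat) (k : nat)
    (a : k.-tuple int) (b : k.-tuple nat) : Prop :=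
  decomposition (m%:R / n%:R) a b /\
  forall x : 'I_k -> int, (forall i, 0 <= x i <= tnth a i) ->
    (exists z : int, frac_sum x b = z%:~R / n%:R) ->
    frac_sum x b = m%:R / n%:R \/ frac_sum x b = 0.

(* 1, ..., 1 (t times), x, 1 *)
Definition numerators (t : nat) (x : int) : t.+2.-tuple int :=
  [tuple of rcons (rcons (nseq t 1) x) 1].

(* b_1, ..., b_(t+1), n * b_1 * ... * b_(t+1) *)
Definition denominators (n t : nat) (b : t.+1.-tuple nat) : t.+2.-tuple nat :=
  [tuple of rcons b (n * \prod_(d <- b) d)%N].

Lemma frac_sum_numerators_denominators (n t : nat) (x : int)
    (b : t.+1.-tuple nat) :
  frac_sum (tnth (numerators t x)) (denominators n b) =
    \sum_(i < t) 1 / (tnth b (widen_ord (leqnSn t) i))%:R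
    + x%:~R / (tnth b ord_max)%:R
    + 1 / (n * \prod_(i < t.+1) tnth b i)%:R.
Proof.
rewrite /frac_sum !big_ord_recr /= -big_ord_recr -(big_tuple _ _ b xpredT id).
congr (_ + _ + _); [apply: eq_bigr => i _ | |];
  rewrite !(tnth_nth (0 : int)) !(tnth_nth 0%N) /=.
- have lt_it := ltn_ord i.
  by rewrite !nth_rcons size_rcons size_nseq size_tuple !ltnS !(ltnW lt_it)
    lt_it nth_nseq lt_it.
- by rewrite !nth_rcons size_rcons size_nseq size_tuple ltnSn ltnn eqxx.
- by rewrite !nth_rcons size_rcons size_nseq size_tuple ltnn eqxx.
Qed.

(* Main.v *)
Require Import Defs.
From mathcomp Require Import all_boot all_order all_algebra.
From mathcomp Require Import zify ring lra.
From mathcomp Require Import finmap.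
From mathcomp Require Import classical_sets cardinality.

(** By the divergence of the sum of the reciprocals of the primes, one can pick
distinct primes b_1, ..., b_t prime to n and to Omega with
0 < r < 1 for r = m/n - 1/b_1 - ... - 1/b_t (subtract until the remainder first
drops below 1; each step removes at most 1/2).  Then r = M/D in lowest terms with
D = n b_1 ... b_t, and every b with M b = 1 + x D gives r = x/b + 1/(D b).  Such
b fill a residue class mod D, and the Chinese remainder theorem provides
infinitely many of them prime to Omega.  Moreover x < b since r < 1.

Faithfulness: if the last fraction is absent from v, then v in (1/n)Z forces
each b_i to divide its numerator x_i < b_i, so v = 0; if it is present, the
same argument applies to m/n - v.  The strict inequality r < 1 also excludes
D = 1, for which the last two denominators would coincide. *)

Set Implicit Arguments.
Unset Strict Implicit.
Unset Printing Implicit Defensive.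

Import Order.TTheory GRing.Theory Num.Theory.

(** * Divergence of the sum of the reciprocals of the primes *)

Lemma sum_dvdn_divn (p X : nat) : (0 < p)%N ->
  (\sum_(i < X) (p %| i.+1) = X %/ p)%N.
Proof.
move=> p_gt0; elim: X => [|X IHX]; first by rewrite big_ord0 div0n.
by rewrite big_ord_recr /= IHX divnS // addnC.
Qed.

(* A smooth number is determined by its valuations at the primes below [L],
   each of which is at most [k]. *)
Lemma card_smooth (L k : nat) :
  (#|[set i : 'I_(2 ^ k) | all (ltn^~ L) (primes i.+1)]| <= k.+1 ^ L)%N.
Proof.
pose f (i : 'I_(2 ^ k)) : {ffun 'I_L -> 'I_k.+1} :=
  [ffun p : 'I_L => inord (logn p i.+1)].
have log_le p (i : 'I_(2 ^ k)) : (logn p i.+1 <= k)%N.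
  case: (boolP (p \in primes i.+1)) => [|]; last first.
    by rewrite -logn_gt0 lt0n negbK => /eqP->.
  rewrite mem_primes => /and3P[p_pr _ _].
  rewrite -(leq_exp2l _ _ (isT : (1 < 2)%N)) (leq_trans _ (ltn_ord i)) //.
  rewrite (leq_trans _ (dvdn_leq _ (pfactor_dvdnn p i.+1))) //.
  by case: (logn p _) => // e; rewrite leq_exp2r ?prime_gt1.
rewrite -[X in (_ <= X ^ _)%N](card_ord k.+1) -[X in (_ <= _ ^ X)%N](card_ord L).
rewrite -card_ffun -(card_in_imset (f := f)) ?max_card //.
move=> i j; rewrite !inE => /allP si /allP sj fij; apply: val_inj.
apply/succn_inj/eqn_from_log => // p; have [ltpL | leLp] := ltnP p L.
  have /ffunP/(_ (Ordinal ltpL)) := fij; rewrite !ffunE => /(congr1 val) /=.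
  by rewrite !inordK ?ltnS ?log_le.
have log0 (l : nat) : {in primes l.+1, forall q, (q < L)%N} -> logn p l.+1 = 0%N.
  move=> sl; apply/eqP; rewrite -leqn0 leqNgt logn_gt0.
  by apply/negP => /sl; rewrite ltnNge leLp.
by rewrite !log0.
Qed.

(* Each number up to [2 ^ k] is [L]-smooth or a multiple of a prime [p >= L]. *)
Lemma leq_smooth_sum (L k : nat) :
  (2 ^ k <= k.+1 ^ L + \sum_(L <= p < (2 ^ k).+1 | prime p) 2 ^ k %/ p)%N.
Proof.
(* Once each quotient is written as a count of multiples and the sums are exchanged, the bound is
   checked for each number [i.+1] separately. *)
under eq_bigr => p p_pr do rewrite -(sum_dvdn_divn _ (prime_gt0 p_pr)).
rewrite exchange_big /= -[X in (X <= _)%N]card_ord -sum1_card.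
apply: leq_trans (leq_add (card_smooth L k) (leqnn _)).
rewrite -sum1_card [X in (_ <= X + _)%N]big_mkcond -big_split /=.
apply: leq_sum => i _; rewrite inE; case: allP => //= /allP/allPn[p].
rewrite mem_primes -leqNgt => /and3P[p_pr _ p_dv] leLp.
rewrite (big_rem p) /= ?p_pr ?p_dv //.
by rewrite mem_index_iota leLp ltnS (leq_trans (dvdn_leq _ p_dv)).
Qed.

(** For such [k] the [L]-smooth numbers make up at most half of the numbers up to [2 ^ k]. *)
Lemma exists_exp_bound (L : nat) : exists k, (2 * k.+1 ^ L <= 2 ^ k)%N.
Proof.
have pow2 j : ((j + 5) * j + 2 <= 2 ^ (j + 4))%N.
  elim: j => // -[|j] IHj //; rewrite addSn expnS.
  apply: leq_trans (leq_mul (leqnn 2) IHj); lia.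
(* With [k.+1 = 2 ^ (L + 4)] both sides are powers of 2, and the exponents to compare are
   [1 + (L + 4) * L] and [2 ^ (L + 4) - 1]. *)
have := pow2 L; exists (2 ^ (L + 4)).-1.
rewrite prednK ?expn_gt0 // -expnM -expnS leq_exp2l //.
nia.
Qed.

Local Open Scope ring_scope.

(** The at least [2 ^ k / 2] numbers that are not smooth are covered by the multiples of primes
    [p >= L], at most [2 ^ k / p] for each [p]. *)
Lemma sum_inv_primes_ge_half (L : nat) : exists N : nat,
  1 / 2 <= \sum_(L <= p < N | prime p) p%:R^-1 :> rat.
Proof.
have [k le_k] := exists_exp_bound L; exists (2 ^ k).+1.
have := leq_smooth_sum L k; rewrite -(ler_nat rat) natrD natr_sum => le_sum.
set S := \sum_(_ <= p < _ | _) _.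
have X_gt0 : 0 < (2 ^ k)%:R :> rat by rewrite ltr0n expn_gt0.
have le_S : \sum_(L <= p < (2 ^ k).+1 | prime p) (2 ^ k %/ p)%:R <= (2 ^ k)%:R * S.
  rewrite mulr_sumr; apply: ler_sum => p p_pr.
  rewrite ler_pdivlMr ?ltr0n ?prime_gt0 // -natrM ler_nat.
  exact: leq_divM.
move: le_k; rewrite -(ler_nat rat) natrM => le_k.
rewrite -(ler_pM2l X_gt0). lra.
Qed.

Lemma sum_inv_primes_unbounded (L C : nat) : exists s : seq nat,
  [/\ uniq s, all prime s, all (leq L) s
    & C%:R / 2 <= \sum_(p <- s) p%:R^-1 :> rat].
Proof.
elim: C L => [|C IHC] L; first by exists [::]; rewrite big_nil mul0r.
have [N leN] := sum_inv_primes_ge_half L.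
(* Starting beyond [N] keeps the further primes disjoint from the block between [L] and [N], which
   is worth 1/2. *)
have [s [s_uniq s_pr s_ge le_s]] := IHC (maxn L N).
exists ([seq p <- index_iota L N | prime p] ++ s); split.
- rewrite cat_uniq s_uniq filter_uniq ?iota_uniq //= andbT.
  apply/hasPn => p /(allP s_ge) /=; rewrite geq_max => /andP[_ leNp].
  by rewrite mem_filter mem_index_iota [(p < N)%N]ltnNge leNp !andbF.
- by rewrite all_cat filter_all.
- rewrite all_cat; apply/andP; split; apply/allP => p.
    by rewrite mem_filter mem_index_iota => /and3P[_ ->].
  by move/(allP s_ge); rewrite /= geq_max => /andP[].
by rewrite big_cat big_filter /= -natr1 mulrDl addrC lerD.
Qed.

(** * The remainder below 1 and its reduced form *)

Lemma subseq_sum_inv_window (s : seq nat) (r : rat) :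
    all (leq 2) s -> 0 < r -> r <= \sum_(p <- s) p%:R^-1 ->
  exists2 s', subseq s' s & 0 < r - \sum_(p <- s') p%:R^-1 < 1.
Proof.
elim: s r => [|p s IHs] r /=.
  (* The bound of [r] by the sum is the invariant: both sides lose 1/p at each step, so the list
     cannot run out while the remainder is positive. *)
  by rewrite big_nil => _ /lt_le_trans /[apply]; rewrite ltxx.
move=> /andP[p_ge s_ge] r_gt0; rewrite big_cons => le_r.
have [lt_r1 | le_1r] := ltP r 1.
  by exists [::]; rewrite ?sub0seq // big_nil subr0 r_gt0.
have p_inv : p%:R^-1 <= 2^-1 :> rat.
  by rewrite lef_pV2 ?ler_nat // posrE ltr0n // (leq_trans _ p_ge).
have [||s' sub_s' wdw] := IHs (r - p%:R^-1) s_ge; [lra | lra |].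
by exists (p :: s'); rewrite /= ?eqxx // big_cons opprD addrA.
Qed.

(** One step is m/n - 1/p = (mp - n)/(np): the new numerator is prime to n because mp is, and prime
    to p because n is. *)
Lemma coprime_sub_sum_inv (s : seq nat) (m : int) (n : nat) :
    (0 < n)%N -> coprimez m n -> all (leq 1) s -> all (coprime n) s ->
    pairwise coprime s ->
  exists2 M : int, coprimez M (n * \prod_(p <- s) p)%N
    & m%:~R / n%:R - \sum_(p <- s) p%:R^-1
        = M%:~R / (n * \prod_(p <- s) p)%:R :> rat.
Proof.
elim: s m n => [|p s IHs] m n n_gt0 co_mn.
  by exists m; rewrite !big_nil muln1 ?subr0.
move=> /= /andP[p_gt0 s_gt0] /andP[co_np co_ns] /andP[co_ps co_s].
have [| | |M coM eqM] := IHs (m * p%:Z - n%:Z) (n * p)%N _ _ s_gt0 _ co_s.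
- by rewrite muln_gt0 n_gt0.
- rewrite PoszM coprimezMr; apply/andP; split.
    rewrite coprimez_sym /coprimez addrC -mulN1r gcdzMDl -/(coprimez _ _).
    by rewrite coprimezMr coprimez_sym co_mn.
  by rewrite coprimez_sym /coprimez gcdzMDl -/(coprimez _ _) coprimezN coprimez_sym.
- apply/allP => q qs; rewrite coprimeMl.
  by rewrite (allP co_ns) //= (allP co_ps).
exists M; rewrite !big_cons mulnA // -eqM natrM rmorphB rmorphM /= opprD addrA.
by congr (_ - _); field; rewrite !pnatr_eq0 -!lt0n p_gt0.
Qed.

(** * The progression of candidates for the last free denominator *)

Lemma inverse_progression (M D W : nat) :
    (0 < M)%N -> (0 < D)%N -> (0 < W)%N -> coprime M D ->
  exists2 f : nat -> nat, injective f
    & forall k, [/\ (1 < f k)%N, coprime (f k) D, coprime (f k) W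
                  & M * f k = 1 %[mod D]].
Proof.
move=> M_gt0 D_gt0 W_gt0 co_MD.
(* [W] may share primes with [D], but being invertible modulo [D] already excludes those. Only the
   part [V] of [W] prime to [D] calls for a congruence. *)
pose V := (W`_(\pi(D)^'))%N.
have V_gt0 : (0 < V)%N := part_gt0 _ _.
have co_DV : coprime D V := pnat_coprime (pnat_pi D_gt0) (part_pnat _ _).
case: (egcdnP D M_gt0) => u v; rewrite (eqP co_MD) => uv _.
(* Here [u] is the inverse of [M] modulo [D], and the factor [k.+2], at least 2, gives [1 < f k]
   even if [D * V = 1]. *)
pose f k := (chinese D V u 1 + k.+2 * (D * V))%N.
have f_modD k : M * f k = 1 %[mod D].
  rewrite -modnMmr /f mulnCA mulnC addnC [(D * _)%N]mulnC modnMDl.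
  by rewrite chinese_modl // modnMml uv modnMDl.
have f_modV k : f k = 1 %[mod V] by rewrite /f mulnA addnC modnMDl chinese_modr.
have f_coD k : coprime (f k) D.
  have : coprime (M * f k) D by rewrite -coprime_modl f_modD coprime_modl coprime1n.
  by rewrite coprimeMl => /andP[].
exists f => [k l /addnI/eqP|k].
  by rewrite eqn_pmul2r ?muln_gt0 ?D_gt0 // => /eqP[].
have f_gt1 : (1 < f k)%N.
  have : (0 < D * V)%N by rewrite muln_gt0 D_gt0.
  by rewrite /f; nia.
split=> //.
rewrite -(partnC \pi(D) W_gt0) coprimeMr; apply/andP; split.
  rewrite coprime_sym (pnat_coprime (part_pnat _ _)) //.
  by rewrite -coprime_pi' ?(ltnW f_gt1) // coprime_sym.
by rewrite -coprime_modl f_modV coprime_modl coprime1n.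
Qed.

(** * Divisibility of numerators and faithfulness *)

Lemma dvdz_num_of_sum (k n : nat) (b : 'I_k -> nat) (y : 'I_k -> int)
    (z : int) :
    (0 < n)%N -> (forall i, (0 < b i)%N) -> (forall i, coprime (b i) n) ->
    (forall i j, i != j -> coprime (b i) (b j)) ->
    \sum_i (y i)%:~R / (b i)%:R = z%:~R / n%:R :> rat ->
  forall i, ((b i)%:Z %| y i)%Z.
Proof.
move=> n_gt0 b_gt0 co_bn co_b sum_y i.
have nzR l : (0 < l)%N -> l%:R != 0 :> rat by rewrite pnatr_eq0 -lt0n.
(* Multiplying the sum by [n * Q] makes every term but the [i]-th an integer, hence that one too;
   and [b i] is prime to [n * Q]. *)
pose Q := (\prod_(j | j != i) b j)%N.
have co_bQ : coprime (b i) Q.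
  rewrite /Q; elim/big_ind: _ => [|p q co_p co_q|j]; first exact: coprimen1.
    by rewrite coprimeMr co_p.
  by rewrite eq_sym => /co_b.
suff : ((b i)%:Z %| y i * (n * Q)%N%:Z)%Z.
  by rewrite Gauss_dvdzl // coprimezE /= coprimeMr co_bn.
suff : (y i)%:~R / (b i)%:R * (n * Q)%:R \is a @Num.int rat.
  case/intrP => w eq_w; apply/dvdzP; exists w; apply: (@intr_inj rat).
  by rewrite !rmorphM /= -eq_w natrM -!pmulrn mulrAC divfK ?nzR.
move: sum_y; rewrite (bigD1 i) //= => /(canRL (addrK _)) ->.
rewrite mulrBl rpredB //.
  rewrite natrM mulrA divfK ?nzR //.
  by rewrite rpredM ?intr_int ?natr_int.
rewrite mulr_suml rpred_sum // => j ij.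
rewrite /Q (bigD1 j) //= !natrM.
rewrite [n%:R * _]mulrCA [_ / _ * _]mulrA divfK ?nzR //.
by rewrite !rpredM ?intr_int ?natr_int.
Qed.

Lemma frac_sum_rcons (k : nat) (x : 'I_k.+1 -> int) (b : k.-tuple nat)
    (e : nat) :
  frac_sum x [tuple of rcons b e]
    = \sum_(i < k) (x (widen_ord (leqnSn k) i))%:~R / (tnth b i)%:R
      + (x ord_max)%:~R / e%:R.
Proof.
rewrite /frac_sum big_ord_recr /=; congr (_ + _).
  apply: eq_bigr => i _; congr (_ / _%:R).
  by rewrite !(tnth_nth 0%N) /= nth_rcons size_tuple ltn_ord.
by rewrite (tnth_nth 0%N) /= nth_rcons size_tuple ltnn eqxx.
Qed.

Lemma tnth_rcons_widen (T : Type) (k : nat) (a : k.-tuple T) (x : T) (i : 'I_k) :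
  tnth [tuple of rcons a x] (widen_ord (leqnSn k) i) = tnth a i.
Proof. by rewrite !(tnth_nth x) /= nth_rcons size_tuple ltn_ord. Qed.

Lemma tnth_rcons_max (T : Type) (k : nat) (a : k.-tuple T) (x : T) :
  tnth [tuple of rcons a x] ord_max = x.
Proof. by rewrite (tnth_nth x) /= nth_rcons size_tuple ltnn eqxx. Qed.

(** The fraction 1/e enters v with coefficient 0 or 1, and passing from v to m/n - v exchanges the
    two cases, so only the denominators in [b] have to be controlled. *)
Lemma faithful_rcons (m n k : nat) (a : k.-tuple int) (b : k.-tuple nat)
    (e : nat) :
    (0 < n)%N -> (0 < e)%N ->
    (forall i, 0 < tnth a i < (tnth b i)%:Z) ->
    (forall i, coprime (tnth b i) n) ->
    (forall i j : 'I_k, i != j -> coprime (tnth b i) (tnth b j)) ->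
    e \notin b ->
    m%:R / n%:R = frac_sum (tnth a) b + 1 / e%:R ->
  faithful_decomposition m n [tuple of rcons a 1] [tuple of rcons b e].
Proof.
move=> n_gt0 e_gt0 ab co_bn co_b e_notin_b eq_mn.
have b_gt1 i : (1 < tnth b i)%N by have := ab i; lia.
have small_sum0 (y : 'I_k -> int) (z : int) :
    (forall i, 0 <= y i <= tnth a i) ->
    frac_sum y b = z%:~R / n%:R -> frac_sum y b = 0.
  move=> y_bd sum_y; have b_gt0 i : (0 < tnth b i)%N := ltnW (b_gt1 i).
  apply: big1 => i _; have := dvdz_num_of_sum n_gt0 b_gt0 co_bn co_b sum_y i.
  have /andP[y_ge0 y_le] := y_bd i; have /andP[_ lt_ab] := ab i.
  have: y i < (tnth b i)%:Z by apply: le_lt_trans lt_ab.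
  case: (y i) y_ge0 => // l _; rewrite ltz_nat => lt_l.
  case: l lt_l => [|l lt_l]; first by rewrite mul0r.
  by rewrite dvdzE /= gtnNdvd.
have sum_split x := frac_sum_rcons x b e.
split; first split.
- by apply/all_tnthP; rewrite all_rcons /=; apply/all_tnthP => i; case/andP: (ab i).
- apply/all_tnthP; rewrite all_rcons /= e_gt0 /=; apply/all_tnthP => i; exact: ltnW.
- rewrite /= rcons_uniq e_notin_b; apply/tuple_uniqP => i j eq_b.
  apply: contraTeq (b_gt1 i) => /co_b; rewrite eq_b /coprime gcdnn => /eqP->.
  by rewrite ltnn.
- rewrite sum_split tnth_rcons_max eq_mn; congr (_ + _).
  by apply: eq_bigr => i _; rewrite tnth_rcons_widen.
move=> x x_bd [z]; rewrite sum_split.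
set y := fun i => x (widen_ord (leqnSn k) i); rewrite -/(frac_sum y b).
have y_bd i : 0 <= y i <= tnth a i.
  by have := x_bd (widen_ord (leqnSn k) i); rewrite tnth_rcons_widen.
have : x ord_max = 0 \/ x ord_max = 1.
  have := x_bd ord_max; rewrite tnth_rcons_max; lia.
case=> -> sum_x.
  by right; move: sum_x; rewrite mul0r addr0 => /(small_sum0 _ _ y_bd).
left; rewrite eq_mn; congr (_ + _); apply/eqP.
rewrite eq_sym -subr_eq0; apply/eqP.
have sub_sum :
    frac_sum (tnth a) b - frac_sum y b = frac_sum (fun i => tnth a i - y i) b.
  rewrite /frac_sum -sumrB; apply: eq_bigr => i _.
  by rewrite rmorphB /= mulrBl.
(* The terms 1/e cancel in m/n - v, which therefore equals (m - z)/n with numerators still between 0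
   and those of [a]. *)
rewrite sub_sum; apply: (small_sum0 _ (m%:Z - z)).
  by move=> i; have := y_bd i; lia.
rewrite -sub_sum rmorphB /= mulrBl -sum_x eq_mn; ring.
Qed.

(** * Assembling the decompositions *)

Lemma pairwise_coprime_primes (s : seq nat) :
  uniq s -> all prime s -> pairwise coprime s.
Proof.
elim: s => //= p s IHs /andP[p_notin s_uniq] /andP[p_pr s_pr].
rewrite IHs // andbT; apply/allP => q qs.
rewrite prime_coprime // dvdn_prime2 ?(allP s_pr _ qs) //.
by apply: contraNneq p_notin => ->.
Qed.

Lemma pairwise_coprime_tnth (k : nat) (b : k.-tuple nat) : pairwise coprime b ->
  forall i j, i != j -> coprime (tnth b i) (tnth b j).
Proof.
move=> /(pairwiseP 0%N) co_b i j; rewrite neq_ltn !(tnth_nth 0%N).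
case/orP => lt_ij; last rewrite coprime_sym; apply: co_b => //;
  by rewrite inE size_tuple ltn_ord.
Qed.

Lemma coprime_prod_seq (b : nat) (s : seq nat) :
  coprime b (\prod_(p <- s) p) = all (coprime b) s.
Proof.
elim: s => [|p s IHs]; first by rewrite big_nil coprimen1.
by rewrite big_cons coprimeMr IHs.
Qed.

Lemma exists_primes_window (W : nat) (r : rat) : 0 < r ->
  exists s : seq nat, [/\ uniq s, all prime s, all (leq W) s
    & 0 < r - \sum_(p <- s) p%:R^-1 < 1].
Proof.
move=> r_gt0.
(* Half of the chosen constant is [Num.truncn r + 1], which exceeds [r]. *)
have [s [s_uniq s_pr s_ge le_s]] :=
  sum_inv_primes_unbounded W (2 * Num.truncn r).+1.+1.
have s_ge2 : all (leq 2) s by apply/allP => p /(allP s_pr)/prime_gt1.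
have le_r : r <= \sum_(p <- s) p%:R^-1.
  apply: le_trans le_s; have := truncnS_gt r.
  rewrite -addn2 natrD natrM -natr1; lra.
have [s' sub_s' wdw] := subseq_sum_inv_window s_ge2 r_gt0 le_r.
have sub_ss' := mem_subseq sub_s'.
exists s'; split=> //; first exact: subseq_uniq sub_s' _.
  by apply/allP => p /sub_ss'/(allP s_pr).
by apply/allP => p /sub_ss'/(allP s_ge).
Qed.

Lemma faithful_rcons_primes (m n M b : nat) (s : seq nat) :
    let D := (n * \prod_(p <- s) p)%N in
    (0 < n)%N -> uniq s -> all prime s -> all (coprime n) s ->
    m%:R / n%:R - \sum_(p <- s) p%:R^-1 = M%:R / D%:R :> rat ->
    (0 < M < D)%N -> (1 < b)%N -> coprime b D -> M * b = 1 %[mod D] ->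
  faithful_decomposition m n (numerators (size s) (M * b %/ D)%N)
    (denominators n [tuple of rcons (in_tuple s) b]).
Proof.
move=> D n_gt0 s_uniq s_pr co_ns eq_mn /andP[M_gt0 lt_MD] b_gt1 co_bD Mb.
have D_gt1 : (1 < D)%N by lia.
set x := (_ %/ _)%N.
(* The division leaves remainder exactly 1, because [1 < D]. *)
have eq_x : (M * b = x * D + 1)%N.
  by rewrite {1}(divn_eq (M * b) D) Mb modn_small.
have s_gt1 p : p \in s -> (1 < p)%N by move/(allP s_pr)/prime_gt1.
move: co_bD; rewrite coprimeMr coprime_prod_seq => /andP[co_bn /allP co_bs].
have prod_rcons : (n * \prod_(d <- rcons s b) d = D * b)%N.
  by rewrite big_rcons /= mulnA.
have in_s (i : 'I_(size s)) : tnth (in_tuple s) i \in s := mem_tnth i (in_tuple s).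
have co_s := pairwise_coprime_primes s_uniq s_pr.
apply: faithful_rcons => //.
- by rewrite prod_rcons muln_gt0; lia.
- move=> i; case: (unliftP ord_max i) => [j|] ->.
    rewrite (_ : lift _ _ = widen_ord (leqnSn _) j); last first.
      by apply: val_inj; rewrite /= /bump leqNgt ltn_ord.
    rewrite !tnth_rcons_widen (tnth_nth 0) /= nth_nseq ltn_ord /=.
    by have := s_gt1 _ (in_s j); rewrite ltz_nat.
  (* Since [x * D = M * b - 1], [x] is positive by [1 < b] and less than [b] by [M < D]. *)
  by rewrite !tnth_rcons_max ltz_nat; nia.
- apply/(all_tnthP (a := fun p => coprime p n)); rewrite all_rcons /= co_bn.
  by apply/allP => p /(allP co_ns); rewrite coprime_sym.
- apply: pairwise_coprime_tnth; rewrite pairwise_rcons co_s andbT.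
  by apply/allP => p ps; rewrite /= coprime_sym co_bs.
(* The last denominator [D * b] differs from [b] as [1 < D], and it is not in [s], whose members are
   prime to [b]. *)
- rewrite prod_rcons mem_rcons inE negb_or; apply/andP; split; first by apply/eqP; nia.
  apply/negP => /= Ds; have := co_bs _ Ds.
  rewrite coprimeMr /coprime gcdnn andbC; lia.
rewrite prod_rcons frac_sum_rcons !tnth_rcons_max.
rewrite (eq_bigr (fun i => (tnth (in_tuple s) i)%:R^-1)); last first.
  move=> i _; rewrite tnth_rcons_widen (tnth_nth 0) /= nth_nseq ltn_ord.
  by rewrite mul1r.
rewrite -(big_tuple _ _ (in_tuple s) xpredT (fun p => p%:R^-1)) /=.
(* What remains is M/D = x/b + 1/(Db), that is, [eq_x] divided by [D * b]. *)
move/(canRL (subrK _)): eq_mn => ->; rewrite addrC -addrA; congr (_ + _).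
have /(congr1 (fun k => k%:R : rat)) := eq_x.
rewrite natrD (natrM _ M) (natrM _ x) => eq_xR.
have D_neq0 : D%:R != 0 :> rat by rewrite pnatr_eq0; lia.
have b_neq0 : b%:R != 0 :> rat by rewrite pnatr_eq0; lia.
have -> : M%:R = (x%:R * D%:R + 1) / b%:R :> rat by rewrite -eq_xR mulfK.
by rewrite (natrM _ D) -pmulrn; field; rewrite b_neq0.
Qed.

Local Open Scope classical_set_scope.

Theorem theorem1p2 (m n : nat) (m_gt0 : (0 < m)%N) (n_gt0 : (0 < n)%N)
    (co_mn : coprime m n)
    (Omega : {fset nat}) (Omega_gt0 : forall w, w \in Omega -> (0 < w)%N) :
  infinite_set
    [set p : {t : nat & (int * t.+1.-tuple nat)%type} |
      let: existT t (x, b) := p in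
      [/\ faithful_decomposition m n (numerators t x) (denominators n b),
          forall i j : 'I_t.+1, i != j -> coprime (tnth b i) (tnth b j)
        & forall (i : 'I_t.+1) (w : nat), w \in Omega ->
            coprime (tnth b i) w]].
Proof.
pose W := (n * \prod_(w <- Omega) w)%N.
have W_gt0 : (0 < W)%N.
  by rewrite muln_gt0 n_gt0 big_seq prodn_cond_gt0.
have r_gt0 : (0 < m%:R / n%:R :> rat)%R by rewrite divr_gt0 ?ltr0n.
(* Primes above [W] cannot divide [W], so they are prime to [n] and to every element of [Omega]. *)
have [s [s_uniq s_pr s_gt wdw]] := exists_primes_window W.+1 r_gt0.
have co_sW p : p \in s -> coprime p W.
  by move=> ps; rewrite prime_coprime ?(allP s_pr) // gtnNdvd // (allP s_gt).
have co_ns : all (coprime n) s.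
  by apply/allP => p /co_sW; rewrite coprimeMr coprime_sym => /andP[].
have s_gt0 : all (leq 1) s by apply/allP => p /(allP s_pr)/prime_gt0.
have co_s := pairwise_coprime_primes s_uniq s_pr.
have [M] := coprime_sub_sum_inv (m := m) n_gt0 co_mn s_gt0 co_ns co_s.
set D := (n * _)%N => co_MD eq_mn.
have D_gt0 : (0 < D)%N.
  by rewrite muln_gt0 n_gt0 big_seq prodn_cond_gt0 // => p /(allP s_gt0).
have /andP[M_gt0 M_ltD] : (0 < M < D)%R.
  move: wdw; rewrite eq_mn pmulr_lgt0 ?invr_gt0 ?ltr0n // ltr_pdivrMr ?ltr0n // mul1r.
  by rewrite ltr0z pmulrn ltr_int.
case: M M_gt0 M_ltD co_MD eq_mn => // M; rewrite !ltz_nat => M_gt0 M_ltD co_MD eq_mn.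
have [f f_inj f_spec] := inverse_progression M_gt0 D_gt0 W_gt0 co_MD.
pose g k : {t : nat & (int * t.+1.-tuple nat)%type} :=
  existT _ (size s) ((M * f k %/ D)%N%:Z, [tuple of rcons (in_tuple s) (f k)]).
have g_inj : injective g.
  (* The primes [s] are fixed and [f k] is the last entry of the tuple; reading it off as a plain
     number avoids comparing dependent pairs. *)
  pose last_b (p : {t : nat & (int * t.+1.-tuple nat)%type}) :=
    last 0%N (projT2 p).2.
  move=> k l /(congr1 last_b); rewrite /last_b /=.
  by rewrite !last_rcons => /f_inj.
(* Were the set finite, so would be its preimage under [g], which is all of [nat]. *)
move=> /(finite_preimage (f := g) (in2W g_inj)); apply: sub_infinite_set infinite_nat.
move=> k _ /=; have [f_gt1 f_coD f_coW f_modD] := f_spec k.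
split.
- by apply: faithful_rcons_primes; rewrite ?M_gt0 ?eq_mn.
- apply: pairwise_coprime_tnth; rewrite pairwise_rcons co_s andbT.
  move: f_coD; rewrite coprimeMr coprime_prod_seq => /andP[_ /allP f_co].
  by apply/allP => p ps; rewrite /= coprime_sym f_co.
- move=> i w wO.
  have co_iW : coprime (tnth [tuple of rcons (in_tuple s) (f k)] i) W.
    have := mem_tnth i [tuple of rcons (in_tuple s) (f k)].
    by rewrite mem_rcons inE => /orP[/eqP->|/co_sW].
  by move: co_iW; rewrite coprimeMr coprime_prod_seq => /andP[_ /allP->].
Qed.
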